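(* Let $\varphi\in[0,2\pi)$, $n\ge 1$, and let $\{L_1,\dots,L_n\}$ be a family of normal operators on $\mathbb{C}^2\otimes\mathbb{C}^2$ that enforces nontrivial phase-locking with phase shift $\varphi$ (as defined in the context). (i) If, up to multiplication of each $L_j$ by a complex number of modulus one, all $L_j$ belong to $\mathcal S_1(\varphi)$, or all $L_j$ belong to $\mathcal S_2(\varphi)$, then the family enforces generalized complete synchronization. (ii) If, for some $\theta\in(-\frac\pi2,0)\cup(0,\frac\pi2)$, all $L_j$ belong to $\mathcal S_\theta(\varphi)$ and at least one of them has parameter $b\neq0$, then the family enforces generalized complete synchronization if and only if $\theta=\frac\pi4$ or $\theta=-\frac\pi4$.
   Context: Two qubits $A$ (first factor) and $B$ (second factor), Hilbert space $\mathscr H=\mathbb{C}^2\otimes\mathbb{C}^2$, $|ij\rangle=|i\rangle\otimes|j\rangle$; matrices are in the ordered basis $(|00\rangle,|01\rangle,|10\rangle,|11\rangle)$. The free Hamiltonian is $H=H_0\otimes I+I\otimes H_0$ with $H_0=\mathrm{diag}(E_0,E_1)$, $E_0,E_1\in\mathbb{R}$, $\Delta E=E_0-E_1\neq0$. The generator is $\mathcal L(\rho)=-i[H,\rho]+\sum_{j=1}^n\left(L_j\rho L_j^\dagger-\frac12\{L_j^\dagger L_j,\rho\}\right)$ and $\mathcal T_t=e^{t\mathcal L}$. The attractor space $\mathrm{Att}(\mathcal T)$ is the direct sum of $\ker(\mathcal L-\lambda I)$ over all purely imaginary eigenvalues $\lambda$ (including $0$) of $\mathcal L$. Put $X_{\Delta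 E}=\mathrm{span}\{|00\rangle\langle01|,|00\rangle\langle10|,|01\rangle\langle11|,|10\rangle\langle11|\}$ and $X_0=\mathrm{span}\{|00\rangle\langle00|,|01\rangle\langle01|,|01\rangle\langle10|,|10\rangle\langle01|,|10\rangle\langle10|,|11\rangle\langle11|\}$. $\mathrm{Tr}_A$, $\mathrm{Tr}_B$ are the partial traces over the first and second factor. The family enforces nontrivial phase-locking with phase shift $\varphi$ if $\mathrm{Tr}_A X=e^{i\varphi}\,\mathrm{Tr}_B X$ for every $X\in\mathrm{Att}(\mathcal T)\cap X_{\Delta E}$ and there is at least one such $X$ with $\mathrm{Tr}_B X\neq 0$. It enforces generalized complete synchronization if it moreover synchronizes the stationary parts: $\mathrm{Tr}_A X=\mathrm{Tr}_B X$ for every $X\in\mathrm{Att}(\mathcal T)\cap X_0$. Sets of operators. $\mathcal S_1(\varphi)$: operators $T_1\begin{pmatrix} c&0&0&0\\ 0&c&0&0\\ 0&0&a&b\\ 0&0&e^{2ik}\bar b&a+me^{ik}\end{pmatrix}T_1^\dagger$, $T_1=\begin{pmatrix}1&0&0&0\\ 0&\frac1{\sqrt2}&\frac1{\sqrt2}&0\\ 0&\frac{e^{i\varphi}}{\sqrt2}&-\frac{e^{i\varphi}}{\sqrt2}&0\\ 0&0&0&1\end{pmatrix}$, with $a,b\in\mathbb{C}$, $c,k,m\in\mathbb{R}$. $\mathcal S_2(\varphi)$: operators $T_2\begin{pmatrix} a&b&0&0\\ e^{2ik}\bar b&a+me^{ik}&0&0\\ 0&0&c&0\\ 0&0&0&c\end{pmatrix}T_2^\dagger$,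 $T_2=\begin{pmatrix}1&0&0&0\\ 0&\frac1{\sqrt2}&\frac1{\sqrt2}&0\\ 0&-\frac{e^{i\varphi}}{\sqrt2}&\frac{e^{i\varphi}}{\sqrt2}&0\\ 0&0&0&1\end{pmatrix}$, with $a,b\in\mathbb{C}$, $c,k,m\in\mathbb{R}$. $\mathcal S_\theta(\varphi)$: operators $T_\theta\begin{pmatrix} a&b&0&0\\ e^{2ik}\bar b&a+me^{ik}&0&0\\ 0&0&a&e^{-2i\theta}b\\ 0&0&e^{2i\theta}e^{2ik}\bar b&a+me^{ik}\end{pmatrix}T_\theta^\dagger$, $T_\theta=\begin{pmatrix}1&0&0&0\\ 0&ie^{-i\varphi}\sin\theta&\cos\theta&0\\ 0&-\cos\theta&-ie^{i\varphi}\sin\theta&0\\ 0&0&0&1\end{pmatrix}$, with $a,b\in\mathbb{C}$, $k,m\in\mathbb{R}$. *)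

(* Defs.v *)
From HB Require Import structures.
From mathcomp Require Import all_boot all_order all_algebra.
From mathcomp Require Import complex mxtens.
From mathcomp Require Import reals trigo.

Set Implicit Arguments.
Unset Strict Implicit.
Unset Printing Implicit Defensive.

Import Order.TTheory GRing.Theory Num.Theory.
Import passmx.
Local Open Scope ring_scope.
Local Open Scope complex_scope.
Local Open Scope sesquilinear_scope.

(* Operators on C^2 (x) C^2.  Indices of 'I_(2 * 2) enumerate the basis in the
   order |00>, |01>, |10>, |11>, since mxtens_index (i, j) = i * 2 + j. *)
Notation qubit_op R := 'M[R[i]]_2.
Notation two_qubit_op R := 'M[R[i]]_(2 * 2).

Section TwoQubits.
Variable R : realType.
Local Notation C := R[i].
Local Notation Op := (two_qubit_op R).

Definition expi (x : R) : C := cos x +i* sin x.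

Definition mx4 (rows : seq (seq C)) : Op :=
  \matrix_(i, j) nth 0 (nth [::] rows i) j.

Definition ket (i j : 'I_2) : 'cV[C]_(2 * 2) :=
  (delta_mx i 0 : 'cV[C]_2) *t (delta_mx j 0 : 'cV[C]_2).

(* |i j><k l| *)
Definition ketbra (i j k l : 'I_2) : Op := ket i j *m (ket k l)^t*.

Definition X_DeltaE : {vspace Op} :=
  span [:: ketbra 0 0 0 1; ketbra 0 0 1 0; ketbra 0 1 1 1; ketbra 1 0 1 1].

Definition X_zero : {vspace Op} :=
  span [:: ketbra 0 0 0 0; ketbra 0 1 0 1; ketbra 0 1 1 0;
          ketbra 1 0 0 1; ketbra 1 0 1 0; ketbra 1 1 1 1].

(* Partial traces over the first, respectively the second, tensor factor. *)
Definition trA (X : Op) : qubit_op R :=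
  \matrix_(k, l) \sum_(i < 2) X (mxtens_index (i, k)) (mxtens_index (i, l)).
Definition trB (X : Op) : qubit_op R :=
  \matrix_(k, l) \sum_(j < 2) X (mxtens_index (k, j)) (mxtens_index (l, j)).

Section Dynamics.
Variables (E0 E1 : R) (n : nat) (L : 'I_n -> Op).

Definition H0 : qubit_op R :=
  diag_mx (\row_(i < 2) (if i == 0 then E0 else E1)%:C).

Definition Ham : Op := H0 *t (1%:M : qubit_op R) + (1%:M : qubit_op R) *t H0.

(* The imaginary unit is written 0 +i* 1: the generic 'i of a numClosedFieldType
   is only specified up to sign. *)
Definition lindblad (rho : Op) : Op :=
  - ((0 +i* 1) *: (Ham *m rho - rho *m Ham))
  + \sum_(j < n) (L j *m rho *m (L j)^t*
      - 2^-1 *: ((L j)^t* *m L j *m rho + rho *m ((L j)^t* *m L j))).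

Fact lindblad_is_linear : linear lindblad.
Proof.
move=> a u v; rewrite /lindblad.
rewrite [a *: (_ + _)]scalerDr scaler_sumr addrACA -big_split /=.
congr (_ + _).
  move: Ham => K.
  rewrite !(mulmxDr, mulmxDl) -!(scalemxAr, scalemxAl) opprD addrACA.
  by rewrite -scalerBr scalerDr opprD scalerN !scalerA mulrC.
apply: eq_bigr => j _.
rewrite !(mulmxDr, mulmxDl) -!(scalemxAr, scalemxAl) addrACA -scalerDr.
by rewrite [2^-1 *: (a *: _ + _)]scalerDr opprD addrACA scalerBr !scalerA mulrC.
Qed.

HB.instance Definition _ :=
  GRing.isLinear.Build C Op Op *:%R lindblad lindblad_is_linear.

(* X lies in the sum of the eigenspaces ker (lindblad - l) over the purely
   imaginary eigenvalues l (0 included).  Eigenspaces of distinct eigenvalues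
   are independent, so the sum is direct, and repetitions in s are harmless. *)
Definition attractor (X : Op) : Prop :=
  exists2 s : seq C,
    all (fun l => leigenvalue (linfun lindblad) l && (complex.Re l == 0)) s &
    X \in (\sum_(l <- s) leigenspace (linfun lindblad) l)%VS.

Definition nontrivial_phase_locking (phi : R) : Prop :=
  (forall X, attractor X -> X \in X_DeltaE -> trA X = expi phi *: trB X) /\
  (exists X, [/\ attractor X, X \in X_DeltaE & trB X <> 0]).

Definition generalized_complete_sync (phi : R) : Prop :=
  nontrivial_phase_locking phi /\
  (forall X, attractor X -> X \in X_zero -> trA X = trB X).

End Dynamics.

Section OperatorSets.
Variable phi : R.

Local Notation rsqrt2 := ((Num.sqrt 2)^-1%:C : C).

Definition T1 : Op := mx4
  [:: [:: 1; 0; 0; 0];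
      [:: 0; rsqrt2; rsqrt2; 0];
      [:: 0; expi phi * rsqrt2; - (expi phi * rsqrt2); 0];
      [:: 0; 0; 0; 1]].

Definition T2 : Op := mx4
  [:: [:: 1; 0; 0; 0];
      [:: 0; rsqrt2; rsqrt2; 0];
      [:: 0; - (expi phi * rsqrt2); expi phi * rsqrt2; 0];
      [:: 0; 0; 0; 1]].

Definition Ttheta (theta : R) : Op := mx4
  [:: [:: 1; 0; 0; 0];
      [:: 0; (0 +i* 1) * expi (- phi) * (sin theta)%:C; (cos theta)%:C; 0];
      [:: 0; - (cos theta)%:C; - ((0 +i* 1) * expi phi * (sin theta)%:C); 0];
      [:: 0; 0; 0; 1]].

Definition S1_op (a b : C) (c k m : R) : Op :=
  T1 *m mx4
    [:: [:: c%:C; 0; 0; 0];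
        [:: 0; c%:C; 0; 0];
        [:: 0; 0; a; b];
        [:: 0; 0; expi (2 * k) * b^*; a + m%:C * expi k]] *m T1^t*.

Definition S2_op (a b : C) (c k m : R) : Op :=
  T2 *m mx4
    [:: [:: a; b; 0; 0];
        [:: expi (2 * k) * b^*; a + m%:C * expi k; 0; 0];
        [:: 0; 0; c%:C; 0];
        [:: 0; 0; 0; c%:C]] *m T2^t*.

Definition Stheta_op (theta : R) (a b : C) (k m : R) : Op :=
  Ttheta theta *m mx4
    [:: [:: a; b; 0; 0];
        [:: expi (2 * k) * b^*; a + m%:C * expi k; 0; 0];
        [:: 0; 0; a; expi (- (2 * theta)) * b];
        [:: 0; 0; expi (2 * theta) * expi (2 * k) * b^*; a + m%:C * expi k]]
  *m (Ttheta theta)^t*.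

Definition S1 (A : Op) : Prop := exists a b c k m, A = S1_op a b c k m.
Definition S2 (A : Op) : Prop := exists a b c k m, A = S2_op a b c k m.
Definition Stheta (theta : R) (A : Op) : Prop :=
  exists a b k m, A = Stheta_op theta a b k m.

End OperatorSets.

Definition up_to_phase (S : Op -> Prop) (A : Op) : Prop :=
  exists2 z : C, `|z| = 1 & S (z *: A).

End TwoQubits.

(* Main.v *)
Require Import Defs.
From HB Require Import structures.
From mathcomp Require Import all_boot all_order all_algebra.
From mathcomp Require Import complex mxtens.
From mathcomp Require Import reals trigo.
From mathcomp Require Import ring lra.

(** If X is an eigenvector of the generator for a purely imaginary eigenvalue
    and all L_j are normal, then 0 = 2 Re tr(X^* L(X)) = - sum_j |[L_j, X]|^2 in
    Hilbert-Schmidt norm, so attractors commute with every L_j and, by Fuglede,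
    with every L_j^*.  Conversely an element of X_0 or X_DeltaE in the commutant
    of the L_j is an attractor, being an eigenvector of [H, -].  On X_0,
    synchronization says that the diagonal entries at 01 and 10 agree.

    For S_1 and S_2 the commutant contains an explicit P in X_DeltaE.  For X in
    the commutant and in X_0, phase-locking of P X and P X^* (or X P and X^* P)
    gives two relations whose sum is that equality.  For S_theta with some
    b <> 0, the elements of X_0 in the commutant are exactly the
    T diag(p, p, q, q) T^*, whose two diagonal entries differ by
    - (p - q) cos (2 theta). *)

Set Implicit Arguments.
Unset Strict Implicit.
Unset Printing Implicit Defensive.

Import Order.TTheory GRing.Theory Num.Theory.
Import passmx.
Local Open Scope ring_scope.
Local Open Scope sesquilinear_scope.

Local Notation b00 := (mxtens_index (0, 0) : 'I_(2 * 2)).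
Local Notation b01 := (mxtens_index (0, 1) : 'I_(2 * 2)).
Local Notation b10 := (mxtens_index (1, 0) : 'I_(2 * 2)).
Local Notation b11 := (mxtens_index (1, 1) : 'I_(2 * 2)).
Local Notation rsqrt2 R := (((Num.sqrt 2)^-1 : R)%:C)%C.

(** * Adjoints and normal matrices *)

Section Adjoint.
Variables (C : numClosedFieldType).

Lemma trmxC_mul m n p (A : 'M[C]_(m, n)) (B : 'M[C]_(n, p)) :
  (A *m B)^t* = B^t* *m A^t*.
Proof. by rewrite trmx_mul map_mxM. Qed.

Lemma mxtrace_trmxC n (A : 'M[C]_n) : \tr (A^t*) = (\tr A)^*.
Proof.
by rewrite /mxtrace rmorph_sum; apply: eq_bigr => i _; rewrite !mxE.
Qed.

Lemma mxtrace_mul_trmxC m n (A : 'M[C]_(m, n)) :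
  \tr (A *m A^t*) = \sum_i \sum_j `|A i j| ^+ 2.
Proof.
apply: eq_bigr => i _; rewrite mxE; apply: eq_bigr => j _.
by rewrite !mxE normCK.
Qed.

Lemma mxtrace_mul_trmxC_ge0 m n (A : 'M[C]_(m, n)) : 0 <= \tr (A *m A^t*).
Proof.
rewrite mxtrace_mul_trmxC; apply: sumr_ge0 => i _; apply: sumr_ge0 => j _.
exact: exprn_ge0.
Qed.

Lemma mxtrace_mul_trmxC_eq0 m n (A : 'M[C]_(m, n)) :
  \tr (A *m A^t*) = 0 -> A = 0.
Proof.
rewrite mxtrace_mul_trmxC => /eqP A0; apply/matrixP => i j.
have rowA_ge0 k : 0 <= \sum_l `|A k l| ^+ 2.
  by apply: sumr_ge0 => l _; apply: exprn_ge0.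
move: A0; rewrite psumr_eq0 // => /allP/(_ i (mem_index_enum i)) /=.
rewrite psumr_eq0 => [|l _]; last exact: exprn_ge0.
move=> /allP/(_ j (mem_index_enum j)) /=.
by rewrite sqrf_eq0 normr_eq0 mxE => /eqP.
Qed.

Lemma mxtrace_conj_real n (A X : 'M[C]_n) : A^t* = A ->
  (\tr (X^t* *m A *m X))^* = \tr (X^t* *m A *m X).
Proof. by move=> hA; rewrite -mxtrace_trmxC !trmxC_mul trmxCK hA mulmxA. Qed.

Definition dissipator n (A X : 'M[C]_n) : 'M[C]_n :=
  A *m X *m A^t* - 2^-1 *: (A^t* *m A *m X + X *m (A^t* *m A)).

(** Expanding the product gives two square terms and two cross terms. Normality turns the square
    term containing A A^* into one containing A^* A, and the cross terms are conjugate to each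
    other. *)
Lemma mxtrace_commutator n (A X : 'M[C]_n) : A \is normalmx ->
  let K := A *m X - X *m A in
  let s := \tr (X^t* *m A *m X *m A^t*) in
  \tr (K *m K^t*) = \tr (X^t* *m (A^t* *m A) *m X)
    + \tr (X *m (A^t* *m A) *m X^t*) - (s + s^*).
Proof.
move=> /normalmxP nA K s.
rewrite /K raddfB map_mxB !trmxC_mul mulmxBr !mulmxBl !raddfB /=.
have -> : \tr (A *m X *m (X^t* *m A^t*)) = \tr (X^t* *m (A^t* *m A) *m X).
  by rewrite mxtrace_mulC !mulmxA.
have -> : \tr (X *m A *m (A^t* *m X^t*)) = \tr (X *m (A^t* *m A) *m X^t*).
  by rewrite -nA !mulmxA.
have -> : \tr (A *m X *m (A^t* *m X^t*)) = s.
  by rewrite /s -!mulmxA [RHS]mxtrace_mulC !mulmxA.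
have -> : \tr (X *m A *m (X^t* *m A^t*)) = s^*.
  rewrite -mxtrace_trmxC !trmxC_mul !trmxCK !mulmxA.
  by rewrite [RHS]mxtrace_mulC !mulmxA.
ring.
Qed.

(** The anticommutator contributes real traces, so adding the conjugate cancels the factor 1/2. What
    remains is the expansion in [mxtrace_commutator] with opposite sign. *)
Lemma mxtrace_dissipator n (A X : 'M[C]_n) : A \is normalmx ->
  let K := A *m X - X *m A in
  let s := \tr (X^t* *m dissipator A X) in
  s + s^* = - \tr (K *m K^t*).
Proof.
move=> nA /=; rewrite mxtrace_commutator //.
have hAA : (A^t* *m A)^t* = A^t* *m A by rewrite trmxC_mul trmxCK.
have r1 := mxtrace_conj_real X hAA.
have := mxtrace_conj_real (X^t*) hAA; rewrite trmxCK => r2.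
have -> : \tr (X^t* *m dissipator A X) =
    \tr (X^t* *m A *m X *m A^t*) - 2^-1 * (\tr (X^t* *m (A^t* *m A) *m X)
      + \tr (X *m (A^t* *m A) *m X^t*)).
  rewrite /dissipator mulmxBr -scalemxAr mulmxDr raddfB /= linearZ /=.
  by rewrite linearD /= [\tr (X^t* *m (X *m _))]mxtrace_mulC !mulmxA.
rewrite rmorphB rmorphM rmorphD /= r1 r2 fmorphV rmorph_nat.
by field.
Qed.

(** Fuglede's theorem in finite dimension. Replacing A by A^* in [mxtrace_commutator] exchanges the
    two cross terms and, by normality, preserves the square terms. Hence [A^*, X] has the same
    Hilbert-Schmidt norm as [A, X], namely 0. *)
Lemma normalmx_comm_adj n (A X : 'M[C]_n) :
  A \is normalmx -> A *m X = X *m A -> A^t* *m X = X *m A^t*.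
Proof.
move=> nA AX; have /normalmxP eA := nA.
have nA' : A^t* \is normalmx by apply/normalmxP; rewrite trmxCK.
apply/subr0_eq/mxtrace_mul_trmxC_eq0.
rewrite mxtrace_commutator // trmxCK eA.
have := mxtrace_commutator X nA; rewrite /= AX subrr mul0mx raddf0.
have -> : \tr (X^t* *m A *m X *m A^t*) = (\tr (X^t* *m A^t* *m X *m A))^*.
  rewrite -mxtrace_trmxC !trmxC_mul !trmxCK [RHS]mxtrace_mulC.
  by rewrite !mulmxA.
by rewrite conjCK [X in _ - X = _]addrC => <-.
Qed.

End Adjoint.

(** * The grading by the number of excitations *)

Section Grading.
Variable R : realType.
Local Notation C := R[i].
Local Notation Op := (two_qubit_op R).

Definition excitations (i : 'I_(2 * 2)) : nat := nth 0 [:: 0; 1; 1; 2]%N i.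

(** Degrees add under multiplication. Degrees 0 and 1 are the spaces [X_zero] and [X_DeltaE], so
    products of their elements can be located without computing entries. *)
Definition graded (d : nat) (X : Op) : Prop :=
  forall i j, excitations j != (excitations i + d)%N -> X i j = 0.

Lemma graded_mul d e X Y : graded d X -> graded e Y -> graded (d + e) (X *m Y).
Proof.
move=> hX hY i j hij; rewrite mxE big1 // => k _.
have [hik|hik] := eqVneq (excitations k) (excitations i + d)%N; last first.
  by rewrite hX // mul0r.
by rewrite hY ?mulr0 // hik -addnA.
Qed.

Lemma graded0_adj X : graded 0 X -> graded 0 (X^t*).
Proof.
move=> hX i j; rewrite addn0 => hij.
by rewrite !mxE hX ?conjC0 // addn0 eq_sym.
Qed.

Lemma ketbraE (i j k l : 'I_2) :
  ketbra R i j k l = delta_mx (mxtens_index (i, j)) (mxtens_index (k, l)).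
Proof.
apply/matrixP => p q; rewrite !mxE big_ord1.
case: (mxtens_indexP p) => p1 p2; case: (mxtens_indexP q) => q1 q2.
have ord1_eq0 (x : 'I_1) : (x == 0) = true by rewrite (ord1 x).
rewrite !mxE !mxtens_indexK /= !ord1_eq0 !andbT.
rewrite !(inj_eq (can_inj (@mxtens_indexK _ _))) !xpair_eqE.
by do 4 case: (_ == _); rewrite /= ?(mulr1, mulr0, mul0r, conjC0, conjC1).
Qed.

Definition energy E0 E1 (i : 'I_(2 * 2)) : R :=
  (2 - (excitations i)%:R) * E0 + (excitations i)%:R * E1.

Lemma HamE E0 E1 i j : Ham E0 E1 i j = ((energy E0 E1 i)%:C)%C *+ (i == j).
Proof.
rewrite /energy /excitations.
case: i => [[|[|[|[|//]]]] hi]; case: j => [[|[|[|[|//]]]] hj];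
  rewrite !mxE /=.
all: apply/eqP; rewrite eq_complex /= ?mulr0n ?mulr1n /=.
all: by apply/andP; split; apply/eqP; ring.
Qed.

Lemma Ham_diag (E0 E1 : R) :
  Ham E0 E1 = diag_mx (\row_i ((energy E0 E1 i)%:C)%C).
Proof. by apply/matrixP => i j; rewrite HamE !mxE. Qed.

Lemma Ham_adj (E0 E1 : R) : (Ham E0 E1)^t* = Ham E0 E1.
Proof.
apply/matrixP => i j; rewrite [LHS]mxE [_^T _ _]mxE !HamE eq_sym.
case: eqP => [->|_]; last by rewrite !mulr0n conjC0.
by rewrite !mulr1n; apply: conjc_real.
Qed.

(** [Ham] is diagonal, so the commutator scales each entry by a difference of two energies. Each
    extra excitation trades one E0 for one E1, so this difference depends on the degree only. *)
Lemma Ham_graded (E0 E1 : R) d X : graded d X ->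
  Ham E0 E1 *m X - X *m Ham E0 E1 = ((d%:R * (E0 - E1))%:C)%C *: X.
Proof.
move=> hX; apply/matrixP => i j.
rewrite Ham_diag mul_diag_mx mul_mx_diag !mxE.
have [hij|hij] := eqVneq (excitations j) (excitations i + d)%N; last first.
  by rewrite hX // !mulr0 mul0r subrr.
rewrite [X in _ - X]mulrC -mulrBl -rmorphB; congr (_%:C%C * _).
by rewrite /energy hij natrD; ring.
Qed.

Lemma graded_span d (s : seq Op) X :
  {in s, forall Y, graded d Y} -> X \in <<s>>%VS -> graded d X.
Proof.
elim: s X => [|Y s IHs] X hs.
  by rewrite span_nil memv0 => /eqP -> i j _; rewrite mxE.
rewrite span_cons => /memv_addP[_ /vlineP[k ->] [Z Zs ->]] i j hij.
rewrite !mxE hs ?mem_head // mulr0 add0r (IHs Z) // => W Ws.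
by apply: hs; rewrite inE Ws orbT.
Qed.

Lemma span_graded d (s : seq Op) X :
  (forall i j, excitations j = (excitations i + d)%N -> delta_mx i j \in s) ->
  graded d X -> X \in <<s>>%VS.
Proof.
move=> hs hX; rewrite [X]matrix_sum_delta.
apply: rpred_sum => i _; apply: rpred_sum => j _.
have [hij|hij] := eqVneq (excitations j) (excitations i + d)%N; last first.
  by rewrite hX // scale0r rpred0.
exact/rpredZ/memv_span/hs.
Qed.

Lemma graded_delta d i j : excitations j = (excitations i + d)%N ->
  graded d (delta_mx i j : Op).
Proof.
move=> hij p q; rewrite mxE; case: andP => // -[/eqP -> /eqP ->].
by rewrite hij eqxx.
Qed.

Lemma ord2P (i : 'I_2) : {i = 0} + {i = 1}.
Proof. by case: i => [[|[|//]]] hi; [left|right]; apply: val_inj. Qed.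

(** Serves [X_zero] and [X_DeltaE] at once: it remains to check over the 16 pairs of basis labels
    that the list contains exactly those of degree [d]. *)
Lemma span_ketbraP d (r : seq ('I_2 * 'I_2 * ('I_2 * 'I_2))) X :
  (forall p q, ((p, q) \in r) = (excitations (mxtens_index q) ==
                           excitations (mxtens_index p) + d)%N) ->
  X \in <<[seq ketbra R t.1.1 t.1.2 t.2.1 t.2.2 | t <- r]>>%VS <-> graded d X.
Proof.
move=> hr; split; [apply: graded_span|apply: span_graded].
  move=> _ /mapP[[[i j] [k l]] rt ->] /=; rewrite ketbraE.
  by apply/graded_delta/eqP; rewrite -hr.
move=> i j; case: (mxtens_indexP i) => i1 i2; case: (mxtens_indexP j) => j1 j2.
move=> hij; rewrite -ketbraE.
apply: (map_f (fun t => ketbra R t.1.1 t.1.2 t.2.1 t.2.2)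
  (x := (i1, i2, (j1, j2)))).
by rewrite hr hij.
Qed.

Lemma X_zeroP X : X \in X_zero R <-> graded 0 X.
Proof.
apply: (@span_ketbraP 0 [:: (0, 0, (0, 0)); (0, 1, (0, 1)); (0, 1, (1, 0));
  (1, 0, (0, 1)); (1, 0, (1, 0)); (1, 1, (1, 1))]) => -[i1 i2] [j1 j2].
by case: (ord2P i1) => ->; case: (ord2P i2) => ->; case: (ord2P j1) => ->;
  case: (ord2P j2) => ->.
Qed.

Lemma X_DeltaEP X : X \in X_DeltaE R <-> graded 1 X.
Proof.
apply: (@span_ketbraP 1 [:: (0, 0, (0, 1)); (0, 0, (1, 0)); (0, 1, (1, 1));
  (1, 0, (1, 1))]) => -[i1 i2] [j1 j2].
by case: (ord2P i1) => ->; case: (ord2P i2) => ->; case: (ord2P j1) => ->;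
  case: (ord2P j2) => ->.
Qed.

End Grading.

(** * Attractors and the commutant *)

Section Dynamics.
Variables (R : realType) (E0 E1 : R) (n : nat).
Local Notation C := R[i].
Local Notation Op := (two_qubit_op R).
Variable L : 'I_n -> Op.
Hypothesis normalL : forall j, L j \is normalmx.

Lemma lindbladE X : lindblad E0 E1 L X =
  - ((0 +i* 1)%C *: (Ham E0 E1 *m X - X *m Ham E0 E1))
  + \sum_j dissipator (L j) X.
Proof. by []. Qed.

Lemma imaginary_conj (l : C) : complex.Re l = 0 -> l + l^* = 0.
Proof.
case: l => a b /= ->; apply/eqP; rewrite eq_complex.
by apply/andP; split; apply/eqP; rewrite /= ?addr0 ?subrr.
Qed.

Lemma eigen_commute l X : complex.Re l = 0 -> lindblad E0 E1 L X = l *: X ->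
  forall j, L j *m X = X *m L j.
Proof.
move=> l0 eX.
pose K j := L j *m X - X *m L j.
pose s Y := \tr (X^t* *m Y).
(* The trace is [l] times the real number tr(X^* X), hence purely imaginary. *)
have sN : s (lindblad E0 E1 L X) + (s (lindblad E0 E1 L X))^* = 0.
  have xx : (s X)^* = s X.
    by rewrite /s -mxtrace_trmxC trmxC_mul trmxCK.
  rewrite eX /s -scalemxAr linearZ /= -/(s X) rmorphM /= xx -mulrDl.
  by rewrite imaginary_conj // mul0r.
(* The Hamiltonian is self-adjoint, so its part of the trace is an imaginary unit times a real
   number and drops out of the real part. *)
have sH : s (- ((0 +i* 1)%C *: (Ham E0 E1 *m X - X *m Ham E0 E1))) +
    (s (- ((0 +i* 1)%C *: (Ham E0 E1 *m X - X *m Ham E0 E1))))^* = 0.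
  have hH := Ham_adj E0 E1.
  have r1 := mxtrace_conj_real X hH.
  have := mxtrace_conj_real (X^t*) hH; rewrite trmxCK => r2.
  have -> : s (- ((0 +i* 1)%C *: (Ham E0 E1 *m X - X *m Ham E0 E1))) =
      - (0 +i* 1)%C * (\tr (X^t* *m Ham E0 E1 *m X)
                       - \tr (X *m Ham E0 E1 *m X^t*)).
    rewrite /s -scaleNr -scalemxAr linearZ /= mulmxBr raddfB /= !mulmxA.
    by rewrite [X in _ = _ * (_ - X)]mxtrace_mulC !mulmxA.
  rewrite rmorphM rmorphB /= r1 r2 -mulrDl imaginary_conj ?mul0r //=.
  by rewrite oppr0.
have : \sum_j \tr (K j *m (K j)^t*) = 0.
  move: sN; rewrite lindbladE /s mulmxDr raddfD rmorphD /= addrACA.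
  rewrite -/(s _) sH add0r mulmx_sumr raddf_sum rmorph_sum -big_split /=.
  rewrite (eq_bigr (fun j => - \tr (K j *m (K j)^t*))) => [|j _].
    by rewrite sumrN => /eqP; rewrite oppr_eq0 => /eqP.
  exact: mxtrace_dissipator.
move=> /eqP; rewrite psumr_eq0 => [/allP K0 j|j _]; last first.
  exact: mxtrace_mul_trmxC_ge0.
have /eqP := K0 j (mem_index_enum j).
by move/mxtrace_mul_trmxC_eq0/subr0_eq.
Qed.

Lemma leigenspaceP l X :
  (X \in leigenspace (linfun (lindblad E0 E1 L)) l) =
  (lindblad E0 E1 L X == l *: X).
Proof.
by rewrite memv_ker add_lfunE opp_lfunE scale_lfunE id_lfunE lfunE subr_eq0.
Qed.

(** Commuting with the L_j is a linear condition, so it passes from eigenvectors to the sum of the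
    eigenspaces. *)
Lemma attractor_commute X : attractor E0 E1 L X ->
  forall j, L j *m X = X *m L j.
Proof.
case=> s; elim: s X => [|l s IHs] X /=.
  by move=> _; rewrite big_nil memv0 => /eqP -> j; rewrite mulmx0 mul0mx.
move=> /andP[/andP[_ /eqP l0] hs]; rewrite big_cons.
case/memv_addP => Y; rewrite leigenspaceP => /eqP eY [Z Zs ->] j.
by rewrite mulmxDr mulmxDl (IHs Z) // (eigen_commute l0 eY).
Qed.

(** Fuglede lets A^* cross X as well, and normality reorders A A^*, so every product in the
    dissipator becomes X A^* A. *)
Lemma dissipator_commute A X :
  A \is normalmx -> A *m X = X *m A -> dissipator A X = 0 :> Op.
Proof.
move=> nA AX; have /normalmxP eA := nA.
have e1 : A *m X *m A^t* = X *m (A^t* *m A) by rewrite AX -mulmxA eA.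
have e2 : A^t* *m A *m X = X *m (A^t* *m A).
  by rewrite -mulmxA AX mulmxA (normalmx_comm_adj nA AX) mulmxA.
have half : 2^-1 + 2^-1 = 1 :> C by field.
by rewrite /dissipator e1 e2 scalerDr -scalerDl half scale1r subrr.
Qed.

Lemma commute_attractor d X : graded d X ->
  (forall j, L j *m X = X *m L j) -> attractor E0 E1 L X.
Proof.
move=> gX hX.
pose l : C := - ((0 +i* 1) * (d%:R * (E0 - E1))%:C)%C.
have eX : lindblad E0 E1 L X = l *: X.
  rewrite lindbladE (Ham_graded _ _ gX) big1 => [|j _].
    by rewrite addr0 scalerA scaleNr.
  exact: dissipator_commute.
(* The zero matrix does not show that [l] is an eigenvalue, so it is placed in the empty sum. *)
have [->|X0] := eqVneq X 0; first by exists [::]; rewrite ?big_nil ?memv0.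
have Xl : X \in leigenspace (linfun (lindblad E0 E1 L)) l.
  by rewrite leigenspaceP eX.
exists [:: l]; last by rewrite big_seq1.
rewrite /= andbT; apply/andP; split; last first.
  by rewrite /l /= mul0r mul1r subr0 oppr0.
by apply: contraNneq X0 => l0; move: Xl; rewrite l0 memv0.
Qed.

End Dynamics.

(** * Entries of operators and of their partial traces *)

Section Entries.
Variable R : realType.
Local Notation C := R[i].
Local Notation Op := (two_qubit_op R).

Lemma basis_ind (P : 'I_(2 * 2) -> Prop) :
  P b00 -> P b01 -> P b10 -> P b11 -> forall i, P i.
Proof.
move=> ? ? ? ? i; case: (mxtens_indexP i) => i1 i2.
by case: (ord2P i1) => ->; case: (ord2P i2) => ->.
Qed.

Lemma sum_ord2 (F : 'I_2 -> C) : \sum_(i < 2) F i = F 0 + F 1.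
Proof.
by rewrite big_ord_recl big_ord1; congr (_ + F _); apply: val_inj.
Qed.

Lemma sum_basis (F : 'I_(2 * 2) -> C) :
  \sum_i F i = F b00 + F b01 + F b10 + F b11.
Proof.
rewrite /= !big_ord_recl big_ord0 addr0 !addrA.
by congr (F _ + F _ + F _ + F _); apply: val_inj.
Qed.

(** In degree 0 both partial traces are diagonal. Each diagonal entry compares the same two
    populations, at 01 and at 10, next to a common term. *)
Lemma trA_eq_trB (X : Op) : graded 0 X ->
  trA X = trB X <-> X b01 b01 = X b10 b10.
Proof.
move=> gX; split.
  by move=> /matrixP/(_ 0 0); rewrite !mxE !sum_ord2 => /addrI ->.
move=> eX; apply/matrixP => i j; rewrite !mxE !sum_ord2.
case: (ord2P i) => ->; case: (ord2P j) => ->.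
- by rewrite eX.
- by rewrite !(gX b00) // !(gX b01) // (gX b10) // addr0.
- by rewrite !(gX b11) // (gX b01) // (gX b10) // addr0.
- by rewrite eX.
Qed.

Lemma trA_phase_trB (e : C) (X : Op) : trA X = e *: trB X ->
  X b00 b01 + X b10 b11 = e * (X b00 b10 + X b01 b11).
Proof. by move=> /matrixP/(_ 0 1); rewrite !mxE !sum_ord2. Qed.

Lemma mx4_graded0 (a b c d p q : C) :
  graded 0 (mx4 [:: [:: a; 0; 0; 0]; [:: 0; b; c; 0];
                    [:: 0; d; p; 0]; [:: 0; 0; 0; q]]).
Proof. by elim/basis_ind; elim/basis_ind => //; rewrite mxE. Qed.

Lemma unitary_conj_comm (T M Y : Op) : T^t* *m T = 1%:M ->
  M *m Y = Y *m M ->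
  (T *m M *m T^t*) *m (T *m Y *m T^t*) = (T *m Y *m T^t*) *m (T *m M *m T^t*).
Proof.
move=> uT MY; rewrite !mulmxA -!(mulmxA _ (T^t*) T) uT !mulmx1.
by rewrite -(mulmxA T M Y) MY mulmxA.
Qed.

End Entries.

(** * Consequences of phase-locking in the commutant *)

Section Locking.
Variables (R : realType) (E0 E1 phi : R) (n : nat).
Local Notation C := R[i].
Local Notation Op := (two_qubit_op R).
Variable L : 'I_n -> Op.
Hypothesis normalL : forall j, L j \is normalmx.
Hypothesis lockL : nontrivial_phase_locking E0 E1 L phi.

Local Notation e := (expi phi).

Let commutant X := forall j, L j *m X = X *m L j.

(** A degree-1 element of the commutant is an attractor in [X_DeltaE], so the locking hypothesis
    applies to it; this is entry (0, 1) of the resulting equality. *)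
Lemma lock_commutant (X : Op) : graded 1 X -> commutant X ->
  X b00 b01 + X b10 b11 = e * (X b00 b10 + X b01 b11).
Proof.
move=> gX cX; apply: trA_phase_trB; apply: lockL.1; last exact/X_DeltaEP.
exact: commute_attractor gX cX.
Qed.

Lemma commutant_mul X Y : commutant X -> commutant Y -> commutant (X *m Y).
Proof. by move=> cX cY j; rewrite mulmxA cX -mulmxA cY mulmxA. Qed.

Lemma commutant_adj X : commutant X -> commutant (X^t*).
Proof.
move=> cX j; have := normalmx_comm_adj (normalL j) (cX j).
by move=> /(congr1 (fun Z => Z^t*)); rewrite !trmxC_mul trmxCK.
Qed.

(** Applying the relation to X^* and conjugating keeps the left side and changes the sign of the
    right side. Adding this to the relation for X shows that twice the left side is 0. *)
Lemma diagonal_sync (u : C) :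
  (forall X, graded 0 X -> commutant X ->
     X b01 b01 - X b10 b10 = u * X b01 b10 - u^* * X b10 b01) ->
  generalized_complete_sync E0 E1 L phi.
Proof.
move=> hu; split=> // X aX /X_zeroP gX; apply/trA_eq_trB => //.
have cX : commutant X := attractor_commute normalL aX.
have h1 := hu X gX cX.
have := hu _ (graded0_adj gX) (commutant_adj cX).
move=> /(congr1 (fun z : C => z^*)).
rewrite !mxE !rmorphB !rmorphM /= !conjCK => h2.
apply/subr0_eq.
have : (X b01 b01 - X b10 b10) + (X b01 b01 - X b10 b10) = 0.
  by rewrite {1}h1 h2; ring.
by rewrite -mulr2n => /eqP; rewrite mulrn_eq0 => /eqP.
Qed.

End Locking.

(** * The operator sets *)

Section Sets.
Variables (R : realType) (phi : R).
Local Notation C := R[i].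
Local Notation Op := (two_qubit_op R).

Lemma conj_realC (x : R) : (x%:C%C : C)^* = x%:C%C.
Proof. exact: conjc_real. Qed.

Lemma conj_expi (x : R) : (expi x)^* = expi (- x).
Proof. by rewrite /expi cosN sinN. Qed.

Lemma expiD (x y : R) : expi (x + y) = expi x * expi y.
Proof.
rewrite /expi cosD sinD; congr (_ +i* _)%C.
by rewrite addrC mulrC [X in _ + X]mulrC.
Qed.

Lemma expi0 : expi (0 : R) = 1.
Proof. by rewrite /expi cos0 sin0. Qed.

Lemma expiN_mul (x : R) : expi (- x) * expi x = 1.
Proof. by rewrite -expiD addNr expi0. Qed.

Lemma rsqrt2_sqr : rsqrt2 R * rsqrt2 R = 2^-1.
Proof.
by rewrite -rmorphM -invfM -expr2 sqr_sqrtr ?ler0n // fmorphV rmorph_nat.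
Qed.

Lemma conj_i : ((0 +i* 1)%C : C)^* = - (0 +i* 1)%C.
Proof. by apply/eqP; rewrite eq_complex /= oppr0 !eqxx. Qed.

Lemma mulii : ((0 +i* 1)%C : C) * (0 +i* 1)%C = - 1.
Proof.
apply/eqP; rewrite eq_complex /= !(mul0r, mulr0, mul1r).
by rewrite sub0r addr0 oppr0 !eqxx.
Qed.

(* The common shape of T1, T2 and Ttheta. *)
Definition middle (x y z w : C) : Op :=
  mx4 [:: [:: 1; 0; 0; 0]; [:: 0; x; y; 0]; [:: 0; z; w; 0]; [:: 0; 0; 0; 1]].

Lemma middle_unitary x y z w :
  x^* * x + z^* * z = 1 -> x^* * y + z^* * w = 0 -> y^* * y + w^* * w = 1 ->
  (middle x y z w)^t* *m middle x y z w = 1%:M.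
Proof.
(* The conjugate of [h2] is the other off-diagonal entry of the product. *)
move=> h1 h2 h3; have h2' := congr1 (fun t : C => t^*) h2.
rewrite rmorphD !rmorphM rmorph0 /= !conjCK (mulrC x) (mulrC z) in h2'.
apply/matrixP; elim/basis_ind; elim/basis_ind; rewrite !mxE sum_basis !mxE /=.
all: by rewrite ?(rmorph0, rmorph1, mul0r, mulr0, mulr1, add0r, addr0).
Qed.

(** [M] is the scalar [c] on the span of the first two basis vectors, hence commutes with the matrix
    units there. Conjugation by [T1] turns this one into an element of the commutant for S_1. *)
Lemma mx4_comm_delta_b00_b01 (c p q u v : C) :
  let M := mx4 [:: [:: c; 0; 0; 0]; [:: 0; c; 0; 0]; [:: 0; 0; p; q];
                   [:: 0; 0; u; v]] in
  M *m delta_mx b00 b01 = delta_mx b00 b01 *m M.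
Proof.
apply/matrixP; elim/basis_ind; elim/basis_ind; rewrite !mxE !sum_basis !mxE /=.
all: by rewrite ?(mul0r, mulr0, mulr1, mul1r, add0r, addr0).
Qed.

(** The counterpart for S_2, whose scalar block is the last one. *)
Lemma mx4_comm_delta_b10_b11 (c p q u v : C) :
  let M := mx4 [:: [:: p; q; 0; 0]; [:: u; v; 0; 0]; [:: 0; 0; c; 0];
                   [:: 0; 0; 0; c]] in
  M *m delta_mx b10 b11 = delta_mx b10 b11 *m M.
Proof.
apply/matrixP; elim/basis_ind; elim/basis_ind; rewrite !mxE !sum_basis !mxE /=.
all: by rewrite ?(mul0r, mulr0, mulr1, mul1r, add0r, addr0).
Qed.

Lemma middle_delta_b00_b01 x y z w :
  middle x y z w *m delta_mx b00 b01 *m (middle x y z w)^t* =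
  mx4 [:: [:: 0; x^*; z^*; 0]; [:: 0; 0; 0; 0]; [:: 0; 0; 0; 0];
          [:: 0; 0; 0; 0]].
Proof.
apply/matrixP; elim/basis_ind; elim/basis_ind.
all: rewrite !mxE !sum_basis !mxE !sum_basis !mxE /=.
all: by rewrite ?(rmorph0, rmorph1, mul0r, mulr0, mulr1, mul1r, add0r, addr0).
Qed.

Lemma middle_delta_b10_b11 x y z w :
  middle x y z w *m delta_mx b10 b11 *m (middle x y z w)^t* =
  mx4 [:: [:: 0; 0; 0; 0]; [:: 0; 0; 0; y]; [:: 0; 0; 0; w];
          [:: 0; 0; 0; 0]].
Proof.
apply/matrixP; elim/basis_ind; elim/basis_ind.
all: rewrite !mxE !sum_basis !mxE !sum_basis !mxE /=.
all: by rewrite ?(rmorph0, rmorph1, mul0r, mulr0, mulr1, mul1r, add0r, addr0).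
Qed.

Lemma T1_unitary : (T1 phi)^t* *m T1 phi = 1%:M.
Proof.
have hr := rsqrt2_sqr; have he := expiN_mul phi.
apply: middle_unitary; rewrite ?rmorphN rmorphM /= !conj_realC conj_expi.
- by rewrite mulrACA he hr; field.
- by rewrite mulrN mulrACA he hr; field.
- by rewrite mulrNN mulrACA he hr; field.
Qed.

Lemma T2_unitary : (T2 phi)^t* *m T2 phi = 1%:M.
Proof.
have hr := rsqrt2_sqr; have he := expiN_mul phi.
apply: middle_unitary; rewrite ?rmorphN rmorphM /= !conj_realC conj_expi.
- by rewrite mulrNN mulrACA he hr; field.
- by rewrite mulNr mulrACA he hr; field.
- by rewrite mulrACA he hr; field.
Qed.

End Sets.

(** * The family S_theta *)

Section Theta.
Variables (R : realType) (phi theta : R).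
Local Notation C := R[i].
Local Notation Op := (two_qubit_op R).

Lemma sqr_cosDsin : ((cos theta)%:C * (cos theta)%:C +
                     (sin theta)%:C * (sin theta)%:C = 1 :> C)%C.
Proof. by rewrite -!rmorphM -rmorphD /= -!expr2 cos2Dsin2. Qed.

Lemma Ttheta_unitary :
  (Ttheta phi theta)^t* *m Ttheta phi theta = 1%:M.
Proof.
have hi := @mulii R; have he := expiN_mul phi; have hcs := sqr_cosDsin.
apply: middle_unitary; rewrite ?(rmorphN, rmorphM) /= !conj_realC;
  rewrite ?conj_i ?conj_expi ?opprK.
all: move: hi he hcs; set c := (cos theta)%:C%C; set s := (sin theta)%:C%C.
all: set e := expi phi; set e' := expi (- phi); set I := (0 +i* 1)%C.
all: move=> hi he hcs.
(* Regrouped so that I^2 = -1, e' e = 1 and c^2 + s^2 = 1 can be substituted. *)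
- transitivity (- (I * I) * (e' * e) * (s * s) + c * c); first by ring.
  by rewrite hi he opprK !mul1r addrC.
- ring.
- transitivity (- (I * I) * (e' * e) * (s * s) + c * c); first by ring.
  by rewrite hi he opprK !mul1r addrC.
Qed.

Lemma middle_diag_entries (x y z w p q : C) :
  let X := middle x y z w *m
    mx4 [:: [:: p; 0; 0; 0]; [:: 0; p; 0; 0]; [:: 0; 0; q; 0]; [:: 0; 0; 0; q]]
    *m (middle x y z w)^t* in
  X b01 b01 = p * (x * x^*) + q * (y * y^*) /\
  X b10 b10 = p * (z * z^*) + q * (w * w^*).
Proof.
split; rewrite !mxE !sum_basis !mxE !sum_basis !mxE /=;
  by rewrite ?(rmorph0, mul0r, mulr0, add0r, addr0); ring.
Qed.

(** The entries are p sin^2 + q cos^2 at 01 and p cos^2 + q sin^2 at 10; the phases in [Ttheta]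
    cancel. *)
Lemma Ttheta_diag_sync (p q : C) :
  let X := Ttheta phi theta *m
    mx4 [:: [:: p; 0; 0; 0]; [:: 0; p; 0; 0]; [:: 0; 0; q; 0]; [:: 0; 0; 0; q]]
    *m (Ttheta phi theta)^t* in
  X b01 b01 - X b10 b10 = (p - q) * (- cos (theta *+ 2))%:C%C.
Proof.
have hi := @mulii R; have he := expiN_mul phi.
move=> X.
have [X1 X2] := middle_diag_entries
  ((0 +i* 1)%C * expi (- phi) * (sin theta)%:C%C) (cos theta)%:C%C
  (- (cos theta)%:C%C) (- ((0 +i* 1)%C * expi phi * (sin theta)%:C%C)) p q.
rewrite [X b01 b01]X1 [X b10 b10]X2.
have -> : - cos (theta *+ 2) = sin theta * sin theta - cos theta * cos theta.
  by rewrite mulr2n cosD opprB.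
rewrite ?(rmorphN, rmorphB, rmorphM) /= !conj_realC.
rewrite ?conj_i ?conj_expi ?opprK.
move: hi he; set c := (cos theta)%:C%C; set s := (sin theta)%:C%C.
set e := expi phi; set e' := expi (- phi); set I := (0 +i* 1)%C.
move=> hi he.
transitivity ((p - q) * (- (I * I) * (e' * e) * (s * s) - c * c)).
  ring.
by rewrite hi he; ring.
Qed.

Lemma cos_mulr2n_eq0 :
  - (pi / 2) < theta /\ theta < 0 \/ 0 < theta /\ theta < pi / 2 ->
  cos (theta *+ 2) = 0 <-> theta = pi / 4 \/ theta = - (pi / 4).
Proof.
have pi0 := pi_gt0 R.
move=> htheta; split; last first.
  have c0 : cos (pi / 4 *+ 2) = 0 :> R.
    by rewrite (_ : _ *+ 2 = pi / 2) ?cos_pihalf //; field.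
  by case=> ->; rewrite ?mulNrn ?cosN.
(* For positive t the angle 2t lies in [0, pi], where cos is injective; negative angles reduce to
   this because cos is even. *)
have main (t : R) : 0 < t -> t < pi / 2 -> cos (t *+ 2) = 0 -> t = pi / 4.
  move=> t0 t1; rewrite -cos_pihalf => /cos_inj; rewrite !in_itv /=.
  have -> : 0 <= t *+ 2 <= pi by apply/andP; split; lra.
  have -> : (0 : R) <= @pi R / 2 <= @pi R by apply/andP; split; lra.
  by move=> /(_ isT isT) h; lra.
case: htheta => -[h1 h2] hc; last by left; apply: main.
right; rewrite -(main (- theta)) ?opprK //; try lra.
by rewrite mulNrn cosN.
Qed.

(** Degree 0 leaves only the diagonal and the 01-10 block of Y. Four entries of MY = YM, after
    cancelling [b] or [v], make that block diagonal and tie its entries to the two outer ones. *)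
Lemma theta_block_commutant (a b b' d u v : C) (Y : Op) : b != 0 -> v != 0 ->
  let M := mx4 [:: [:: a; b; 0; 0]; [:: b'; d; 0; 0]; [:: 0; 0; a; u];
                   [:: 0; 0; v; d]] in
  graded 0 Y -> M *m Y = Y *m M ->
  Y = mx4 [:: [:: Y b00 b00; 0; 0; 0]; [:: 0; Y b00 b00; 0; 0];
              [:: 0; 0; Y b11 b11; 0]; [:: 0; 0; 0; Y b11 b11]].
Proof.
move=> b0 v0 M gY MY.
have := congr1 (fun Z : Op => Z b00 b01) MY.
have := congr1 (fun Z : Op => Z b00 b10) MY.
have := congr1 (fun Z : Op => Z b11 b01) MY.
have := congr1 (fun Z : Op => Z b11 b10) MY.
rewrite !mxE !sum_basis !mxE /=.
have z1 : Y b00 b01 = 0 by apply: gY.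
have z2 : Y b00 b10 = 0 by apply: gY.
have z3 : Y b00 b11 = 0 by apply: gY.
have z4 : Y b01 b11 = 0 by apply: gY.
have z5 : Y b10 b11 = 0 by apply: gY.
have z6 : Y b11 b01 = 0 by apply: gY.
have z7 : Y b11 b10 = 0 by apply: gY.
have z8 : Y b11 b00 = 0 by apply: gY.
have z9 : Y b01 b00 = 0 by apply: gY.
have z10 : Y b10 b00 = 0 by apply: gY.
rewrite !(z1, z2, z3, z4, z5, z6, z7, z8, z9, z10).
rewrite !(mul0r, mulr0, add0r, addr0) => h1 h2 h3 h4.
have e1 : Y b10 b10 = Y b11 b11 by apply: (mulfI v0); rewrite h1 mulrC.
have e2 : Y b10 b01 = 0 by apply: (mulfI v0); rewrite h2 mulr0.
have e3 : Y b01 b10 = 0 by apply: (mulfI b0); rewrite h3 mulr0.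
have e4 : Y b01 b01 = Y b00 b00 by apply: (mulfI b0); rewrite h4 mulrC.
by apply/matrixP; elim/basis_ind; elim/basis_ind; rewrite mxE /=.
Qed.

Lemma theta_block_comm_diag (a b b' d u v p q : C) :
  let M := mx4 [:: [:: a; b; 0; 0]; [:: b'; d; 0; 0]; [:: 0; 0; a; u];
                   [:: 0; 0; v; d]] in
  let Y := mx4 [:: [:: p; 0; 0; 0]; [:: 0; p; 0; 0]; [:: 0; 0; q; 0];
                   [:: 0; 0; 0; q]] in
  M *m Y = Y *m M.
Proof.
apply/matrixP; elim/basis_ind; elim/basis_ind; rewrite !mxE !sum_basis !mxE /=.
all: by rewrite ?(mul0r, mulr0, add0r, addr0) // mulrC.
Qed.

End Theta.

(** * Synchronization *)

Section Main.
Variables (R : realType) (E0 E1 phi : R) (n : nat).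
Local Notation C := R[i].
Local Notation Op := (two_qubit_op R).
Variable L : 'I_n -> Op.
Hypothesis normalL : forall j, L j \is normalmx.

Local Notation e := (expi phi).

Lemma expi_neq0 (x : R) : expi x != 0.
Proof.
apply/eqP => x0; have := expiN_mul x.
by rewrite x0 mulr0 => /esym/eqP; rewrite oner_eq0.
Qed.

Lemma rsqrt2_neq0 : rsqrt2 R != 0 :> C.
Proof.
apply/eqP => r0; have := rsqrt2_sqr R.
by rewrite r0 mulr0 => /esym/eqP; rewrite invr_eq0 pnatr_eq0.
Qed.

Lemma up_to_phase_comm (S : Op -> Prop) (A X : Op) :
  (forall B, S B -> B *m X = X *m B) -> up_to_phase S A -> A *m X = X *m A.
Proof.
move=> hS [z z1 /hS zAX].
have z0 : z != 0 by rewrite -normr_eq0 z1 oner_eq0.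
by apply: (scalerI z0); rewrite scalemxAl zAX -scalemxAr.
Qed.

(** Here P = |00><psi| with psi = (|01> + e |10>) / sqrt 2, the image under [T1] of its second basis
    vector. *)
Lemma S1_sync : nontrivial_phase_locking E0 E1 L phi ->
  (forall j, up_to_phase (S1 phi) (L j)) ->
  generalized_complete_sync E0 E1 L phi.
Proof.
move=> lockL hS; apply: (diagonal_sync normalL lockL (u := e)) => X gX cX.
pose P : Op := T1 phi *m delta_mx b00 b01 *m (T1 phi)^t*.
have gT : graded 0 (T1 phi) by apply: mx4_graded0.
have gP : graded 1 P.
  apply: (graded_mul (d := 1) (e := 0)); last exact: graded0_adj.
  by apply: (graded_mul (d := 0) (e := 1)); last exact: graded_delta.
have cP j : L j *m P = P *m L j.
  apply: up_to_phase_comm (hS j) => _ [a [b [c [k [m ->]]]]].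
  exact: unitary_conj_comm (T1_unitary phi) (mx4_comm_delta_b00_b01 _ _ _ _ _).
(* Only row 00 of P X is nonzero, so locking relates its entries at 01 and 10; dividing by [r] gives
   the relation with u = e. *)
have := lock_commutant normalL lockL (graded_mul gP gX) (commutant_mul cP cX).
rewrite /P [T1 phi]/(middle _ _ _ _) middle_delta_b00_b01.
rewrite !mxE !sum_basis !mxE /=.
rewrite !(mul0r, add0r, addr0) rmorphM /= conj_realC conj_expi.
have he := expiN_mul phi; move: he rsqrt2_neq0.
set r := rsqrt2 R; set e' := expi (- phi) => he r0 h; apply: (mulfI r0).
transitivity (r * X b01 b01 + e' * r * X b10 b01 - r * X b10 b10
  - e' * r * X b10 b01); first by ring.
rewrite h; transitivity (e * r * X b01 b10 + (e' * e) * (r * X b10 b10)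
  - r * X b10 b10 - e' * r * X b10 b01); first by ring.
by rewrite he; ring.
Qed.

(** The mirror image of S_1: P = |psi><11| with the same psi, now the third column of [T2], and X
    multiplies from the left. *)
Lemma S2_sync : nontrivial_phase_locking E0 E1 L phi ->
  (forall j, up_to_phase (S2 phi) (L j)) ->
  generalized_complete_sync E0 E1 L phi.
Proof.
move=> lockL hS; apply: (diagonal_sync normalL lockL (u := - e)) => X gX cX.
pose P : Op := T2 phi *m delta_mx b10 b11 *m (T2 phi)^t*.
have gT : graded 0 (T2 phi) by apply: mx4_graded0.
have gP : graded 1 P.
  apply: (graded_mul (d := 1) (e := 0)); last exact: graded0_adj.
  by apply: (graded_mul (d := 0) (e := 1)); last exact: graded_delta.
have cP j : L j *m P = P *m L j.
  apply: up_to_phase_comm (hS j) => _ [a [b [c [k [m ->]]]]].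
  exact: unitary_conj_comm (T2_unitary phi) (mx4_comm_delta_b10_b11 _ _ _ _ _).
have := lock_commutant normalL lockL (graded_mul gX gP) (commutant_mul cX cP).
rewrite /P [T2 phi]/(middle _ _ _ _) middle_delta_b10_b11.
rewrite !mxE !sum_basis !mxE /=.
rewrite !(mulr0, add0r, addr0) rmorphN /= conj_expi.
have he := expiN_mul phi; have e0 := expi_neq0 phi; move: he rsqrt2_neq0.
set r := rsqrt2 R; set e' := expi (- phi) => he r0 h.
(* Locking of X P multiplies the entry at 01 by [e], so the relation appears with a factor
   [e * r]. *)
apply: (mulfI (mulf_neq0 r0 e0)).
transitivity (e * (X b01 b01 * r + X b01 b10 * (e * r))
  - e * e * r * X b01 b10 - e * r * X b10 b10); first by ring.
rewrite -h; transitivity (r * X b10 b01 - e * e * r * X b01 b10); first by ring.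
transitivity (r * (e' * e) * X b10 b01 - e * e * r * X b01 b10); last by ring.
by rewrite he mulr1.
Qed.

Lemma Stheta_sync theta :
  nontrivial_phase_locking E0 E1 L phi ->
  (forall j, Stheta phi theta (L j)) ->
  (exists j a b k m, L j = Stheta_op phi theta a b k m /\ b != 0) ->
  generalized_complete_sync E0 E1 L phi <-> cos (theta *+ 2) = 0.
Proof.
move=> lockL hS hb.
have uT := Ttheta_unitary phi theta.
have gT : graded 0 (Ttheta phi theta) by apply: mx4_graded0.
split=> [[_ hsync]|cos0].
  (* The projector onto the first block, p = 1 and q = 0, conjugates to an attractor whose two
     populations differ by - cos (2 theta); synchronization makes this 0. *)
  pose Y : Op := mx4 [:: [:: 1; 0; 0; 0]; [:: 0; 1; 0; 0]; [:: 0; 0; 0; 0];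
                   [:: 0; 0; 0; 0]].
  pose X := Ttheta phi theta *m Y *m (Ttheta phi theta)^t*.
  have gX : graded 0 X.
    apply: (graded_mul (d := 0) (e := 0)); last exact: graded0_adj.
    by apply: (graded_mul (d := 0) (e := 0)) => //; apply: mx4_graded0.
  have cX j : L j *m X = X *m L j.
    have [a [b [k [m ->]]]] := hS j.
    exact: unitary_conj_comm uT (theta_block_comm_diag _ _ _ _ _ _ _ _).
  have /(trA_eq_trB gX) : trA X = trB X.
    by apply: hsync; [apply: commute_attractor gX cX|apply/X_zeroP].
  have /= := Ttheta_diag_sync phi theta 1 0; rewrite -/Y -/X => hX eX.
  move: hX; rewrite eX subrr subr0 mul1r rmorphN => /eqP.
  by rewrite eq_sym oppr_eq0 fmorph_eq0 => /eqP.
split=> // X aX /X_zeroP gX; apply/trA_eq_trB => //.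
have cX := attractor_commute normalL aX.
have [j [a [b [k [m [Lj b0]]]]]] := hb.
have v0 : expi (2 * theta) * expi (2 * k) * b^* != 0.
  by rewrite !mulf_neq0 ?expi_neq0 ?conjC_eq0.
(* In the frame of [Ttheta] the operator with b <> 0 is block diagonal, and its commutation with Y
   forces Y = diag(p, p, q, q). *)
pose Y := (Ttheta phi theta)^t* *m X *m Ttheta phi theta.
have gY : graded 0 Y.
  apply: (graded_mul (d := 0) (e := 0)) => //.
  by apply: (graded_mul (d := 0) (e := 0)) => //; apply: graded0_adj.
have uT' := mulmx1C uT.
have eX : X = Ttheta phi theta *m Y *m (Ttheta phi theta)^t*.
  by rewrite /Y !mulmxA uT' mul1mx -mulmxA uT' mulmx1.
have := cX j; rewrite Lj /Stheta_op; set M := mx4 _ => MX.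
have MY : M *m Y = Y *m M.
  have := congr1 (fun Z => (Ttheta phi theta)^t* *m Z *m Ttheta phi theta) MX.
  by rewrite /Y !mulmxA uT mul1mx -!(mulmxA _ _ (Ttheta phi theta)) uT mulmx1.
have eY := theta_block_commutant b0 v0 gY MY.
apply/subr0_eq; rewrite eX eY Ttheta_diag_sync cos0 oppr0.
exact: mulr0.
Qed.

End Main.

Theorem mainTheorem4 (R : realType) (E0 E1 : R) (hE : E0 - E1 != 0)
    (phi : R) (hphi0 : 0 <= phi) (hphi1 : phi < 2 * pi)
    (n : nat) (hn : (1 <= n)%N) (L : 'I_n -> two_qubit_op R)
    (hnormal : forall j, L j \is normalmx)
    (hlock : nontrivial_phase_locking E0 E1 L phi) :
  ((forall j, up_to_phase (S1 phi) (L j)) \/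
   (forall j, up_to_phase (S2 phi) (L j)) ->
   generalized_complete_sync E0 E1 L phi)
  /\
  (forall theta : R,
     (- (pi / 2) < theta /\ theta < 0) \/ (0 < theta /\ theta < pi / 2) ->
     (forall j, Stheta phi theta (L j)) ->
     (exists j a b k m, L j = Stheta_op phi theta a b k m /\ b != 0) ->
     (generalized_complete_sync E0 E1 L phi <->
      theta = pi / 4 \/ theta = - (pi / 4))).
Proof.
split=> [[hS|hS]|theta htheta hS hb]; first exact: S1_sync.
  exact: S2_sync.
by rewrite -cos_mulr2n_eq0 //; apply: Stheta_sync.
Qed.
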